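(* Let $X$ be a set of $n$ variables and let $\mathcal{X}=(X,\{X_1,\ldots,X_m\})$ be a hypergraph with non-empty edges $X_i\subseteq X$ (repetitions allowed). Let $q(\mathcal{X})$ be the probability that the randomly generated system $f_1(X_1)=0,\ldots,f_m(X_m)=0$ over $\mathbb{F}_2$ has at least one solution in $\mathbb{F}_2^n$. Then $$\frac{3\cdot 2^{n}}{2^{m+1}}-\frac{2^{2n}}{2^{2m+1}}\sum_{\{i_1,\ldots,i_r\}}2^{-|X_{i_1}\cup\cdots\cup X_{i_r}|}\;\leq\; q(\mathcal{X})\;\leq\;\frac{2^{n}}{2^{m}},$$ where the sum runs over all subsets $\{i_1,\ldots,i_r\}\subseteq\{1,\ldots,m\}$ (including the empty subset, whose union is empty and which contributes $1$).
   Context: A randomly generated system on the hypergraph $\mathcal{X}=(X,\{X_1,\ldots,X_m\})$, $|X|=n$: the variable sets $X_1,\ldots,X_m$ are fixed, and for each $i$ the polynomial $f_i$ is chosen independently and uniformly at random among all $2^{2^{|X_i|}}$ Boolean polynomials over $\mathbb{F}_2$ in the variables $X_i$ (equivalently, all functions $\mathbb{F}_2^{X_i}\to\mathbb{F}_2$). The system is consistent if some $a\in\mathbb{F}_2^n$ satisfies all equations $f_i=0$ (each $f_i$ evaluated at the restriction of $a$ to $X_i$). *)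

(* Defs.v *)
From mathcomp Require Import all_boot all_order all_algebra.
Set Implicit Arguments.
Unset Strict Implicit.
Unset Printing Implicit Defensive.
Import GRing.Theory Num.Theory.
Local Open Scope ring_scope.

Section BooleanSystems.
Variable X : finType.

(* The variables in A form the subtype {x | x \in A}; a point of F_2^A. *)
Definition point (A : {set X}) : finType := {ffun {x | x \in A} -> 'F_2}.

(* A Boolean polynomial in the variables A is a polynomial over F_2 of degree
   at most 1 in each variable, given by its coefficients: f S is the
   coefficient of the monomial \prod_(x in S) x, for S a set of variables
   of A. *)
Definition boolpoly (A : {set X}) : finType :=
  {ffun {set {x | x \in A}} -> 'F_2}.

Definition boolpoly_eval (A : {set X}) (f : boolpoly A) (a : point A) : 'F_2 :=
  \sum_(S : {set {x | x \in A}}) f S * \prod_(x in S) a x.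

Definition restrict (A : {set X}) (a : {ffun X -> 'F_2}) : point A :=
  [ffun x => a (val x)].

Variables (m : nat) (E : 'I_m -> {set X}).

Definition bsystem : finType := {dffun forall i : 'I_m, boolpoly (E i)}.

Definition consistent (f : bsystem) : bool :=
  [exists a : {ffun X -> 'F_2},
    forall i : 'I_m, boolpoly_eval (f i) (restrict (E i) a) == 0].

(* Independent and uniform choice of the f i: the product of the uniform
   distributions on the sets boolpoly (E i). *)
Definition system_prob (f : bsystem) : rat :=
  \prod_(i < m) #|boolpoly (E i)|%:R^-1.

Definition consistency_prob : rat :=
  \sum_(f : bsystem | consistent f) system_prob f.

End BooleanSystems.

(* Main.v *)
(** Let N be the number of solutions of the random system, so that q is the
    probability that N >= 1.  The upper bound is q <= E[N].  The lower bound
    follows from the inequality 3 N - N^2 <= 2 [N >= 1], valid for every natural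
    number N, by taking expectations: E[N^2] is a sum over pairs of points of
    the products over i of (1 + [a = b on X_i]) / 4, and expanding each product
    over the subsets I of the index set leaves the number of pairs of points
    which agree on the union of the X_i with i in I. *)

Require Import Defs.
From HB Require Import structures.
From mathcomp Require Import all_boot all_order all_algebra.
From mathcomp Require Import ring lra.
Import GRing.Theory Num.Theory.
Local Open Scope ring_scope.

(** Joins the finite and the additive structure, so that coefficient functions and pairs of values
    form finite groups. *)
HB.instance Definition _ (T : finType) (V : finZmodType) :=
  Finite.on {ffun T -> V}.

HB.instance Definition _ (V W : finZmodType) := Finite.on (V * W)%type.

(** The fibre over [z] is the translate of the fibre over [w] by any preimage of [z - w]; so [V]
    splits into [#|W|] fibres of equal size. *)
Lemma card_fiber_surj_additive (V W : finZmodType) (phi : {additive V -> W})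
    (w : W) :
  (forall z : W, exists v : V, phi v = z) ->
  (#|[pred v | phi v == w]| * #|W|)%N = #|V|.
Proof.
move=> surj.
have fiberE z : #|[pred v | phi v == z]| = #|[pred v | phi v == w]|.
  have [v0 v0E] := surj (z - w).
  rewrite -[RHS](card_image (@addrI _ v0)); apply: eq_card => v.
  apply/idP/imageP => [/eqP phiv|[u /eqP phiu ->]]; last first.
    by rewrite inE raddfD v0E phiu subrK.
  by exists (v - v0); rewrite ?inE ?raddfB ?v0E ?phiv ?subKr // addrC subrK.
rewrite mulnC -sum_nat_const -[RHS]sum1_card.
rewrite (partition_big phi xpredT) //=; apply: eq_bigr => z _.
by rewrite sum1_card -(fiberE z).
Qed.

Lemma prob_fiber_surj_additive (V W : finZmodType) (phi : {additive V -> W})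
    (w : W) :
  (forall z : W, exists v : V, phi v = z) ->
  #|[pred v | phi v == w]|%:R / #|V|%:R = #|W|%:R^-1 :> rat.
Proof.
move=> /(card_fiber_surj_additive _ _ _ w) VE.
have : (#|V|%:R : rat) != 0.
  by rewrite pnatr_eq0 -lt0n; apply/card_gt0P; exists 0.
rewrite -VE natrM mulf_eq0 negb_or => /andP[fiber0 W0].
by rewrite invfM mulrA divff // mul1r.
Qed.

Section Evaluation.
Variables (X : finType) (A : {set X}).
Implicit Types (p q : point A) (f g : {ffun {set {x | x \in A}} -> 'F_2}).

(* [boolpoly A] is a bare [finType]: the additive structure is only available
   on the underlying type of finite functions. *)
Definition eval1 p f : 'F_2 := boolpoly_eval (A := A) f p.

Definition eval2 p q f : 'F_2 * 'F_2 := (eval1 p f, eval1 q f).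

Lemma eval1B p : zmod_morphism (eval1 p).
Proof.
move=> f g; rewrite /eval1 /boolpoly_eval -sumrB; apply: eq_bigr => S _.
by rewrite !ffunE mulrBl.
Qed.

Lemma eval2B p q : zmod_morphism (eval2 p q).
Proof. by move=> f g; rewrite /eval2 !eval1B. Qed.

HB.instance Definition _ p :=
  GRing.isZmodMorphism.Build _ _ (eval1 p) (eval1B p).

HB.instance Definition _ p q :=
  GRing.isZmodMorphism.Build _ _ (eval2 p q) (eval2B p q).

Definition monomial (S : {set {x | x \in A}}) (c : 'F_2) :
  {ffun {set {x | x \in A}} -> 'F_2} := [ffun T => if T == S then c else 0].

Lemma eval1_monomial S c p :
  eval1 p (monomial S c) = c * \prod_(x in S) p x.
Proof.
rewrite /eval1 /boolpoly_eval (bigD1 S) //= ffunE eqxx.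
rewrite [X in _ + X]big1 ?addr0 // => T TS.
by rewrite ffunE (negPf TS) mul0r.
Qed.

Lemma eval1_surj p (c : 'F_2) : exists f, eval1 p f = c.
Proof.
by exists (monomial set0 c); rewrite eval1_monomial big_set0 mulr1.
Qed.

(* An affine polynomial in one variable on which p and q differ interpolates. *)
Lemma eval2_surj p q (c : 'F_2 * 'F_2) : p != q -> exists f, eval2 p q f = c.
Proof.
move=> npq; have [x px] : exists x, p x - q x != 0.
  apply/existsP; apply: contraNT npq => /existsPn eqpq.
  by apply/eqP/ffunP => x; apply/eqP; rewrite -subr_eq0; apply: negbNE.
pose t := (c.1 - c.2) / (p x - q x).
exists (monomial set0 (c.1 - t * p x) + monomial [set x] t).
have evalD r : {morph eval1 r : f g / f + g} by exact: raddfD.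
rewrite /eval2 !evalD !eval1_monomial !big_set0 !big_set1 !mulr1.
rewrite subrK [RHS]surjective_pairing; congr pair.
have : t * (p x - q x) = c.1 - c.2 by rewrite divfK.
move/eqP; rewrite mulrBr subr_eq => /eqP ->; ring.
Qed.

(** The value at one point is uniform on ['F_2], which gives 1/2 when [p = q]; for distinct points
    the pair of values is uniform on the four elements of ['F_2 * 'F_2]. *)
Lemma prob_root2 p q :
  #|[pred f : boolpoly A |
      (boolpoly_eval f p == 0) && (boolpoly_eval f q == 0)]|%:R
    / #|boolpoly A|%:R = (1 + (p == q)%:R) / 4 :> rat.
Proof.
have cardF2 : #|'F_2| = 2%N by rewrite card_ord.
have [<-|npq] := eqVneq p q.
  rewrite (eq_card (B := [pred f | eval1 p f == 0])); last first.
    by move=> f; rewrite !inE andbb.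
  apply: etrans (prob_fiber_surj_additive _ _ (eval1 p) 0 (eval1_surj p)) _.
  by rewrite cardF2.
rewrite (eq_card (B := [pred f | eval2 p q f == 0])); last first.
  by move=> f; rewrite !inE.
apply: etrans (prob_fiber_surj_additive _ _ (eval2 p q) 0 _) _.
  by move=> c; apply: eval2_surj.
by rewrite card_prod cardF2 addr0 mul1r.
Qed.

End Evaluation.

(** The coordinates of [b] in [U] are forced and each of the others has two choices. *)
Lemma card_agree_on (X : finType) (U : {set X}) (a : {ffun X -> 'F_2}) :
  #|[pred b : {ffun X -> 'F_2} | [forall x in U, a x == b x]]|%:R
    = 2 ^+ #|X| / 2 ^+ #|U| :> rat.
Proof.
pose F x : pred 'F_2 := [pred c | (x \in U) ==> (a x == c)].
rewrite (eq_card (B := family F)) => [|b]; last by rewrite !inE.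
rewrite card_family foldrE big_map big_enum /= (bigID (mem U)) /=.
rewrite big1 => [|x Ux]; last first.
  by apply: etrans (card1 (a x)); apply: eq_card => c; rewrite !inE Ux eq_sym.
rewrite mul1n (eq_bigr (fun=> 2%N)) => [|x Ux]; last first.
  apply: etrans (card_ord 2); apply: eq_card => c.
  by rewrite !inE (negPf Ux).
by rewrite prod_nat_const natrX -(cardC U) exprD mulrC mulKf ?expf_neq0.
Qed.

Section Moments.
Variables (X : finType) (m : nat) (E : 'I_m -> {set X}).
Implicit Types (f : bsystem E) (a b : {ffun X -> 'F_2}).

Definition solution f a : bool :=
  [forall i, boolpoly_eval (f i) (restrict (E i) a) == 0].

Definition solution_number f : nat := #|[pred a | solution f a]|.

Lemma system_prob_ge0 f : 0 <= system_prob f.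
Proof. by apply: prodr_ge0 => i _; rewrite invr_ge0 ler0n. Qed.

(** This is the independence of the equations: the event is a product set under a uniform product
    measure. *)
Lemma system_prob_family (F : forall i, pred (boolpoly (E i))) :
  \sum_(f : bsystem E | [forall i, F i (f i)]) system_prob f
    = \prod_i (#|F i|%:R / #|boolpoly (E i)|%:R).
Proof.
rewrite sumr_const big_split /= -[LHS]mulr_natl; congr (_ * _).
rewrite -natr_prod; congr (_%:R).
rewrite (@eq_card (bsystem E) _ (family F)) => [|f]; last by rewrite !inE.
by rewrite card_family foldrE big_map big_enum.
Qed.

Lemma restrict_eq (A : {set X}) a b :
  (restrict A a == restrict A b) = [forall x in A, a x == b x].
Proof.
apply/eqP/forall_inP => [/ffunP ab x Ax|ab].
  by have := ab (exist _ x Ax); rewrite !ffunE => /eqP.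
by apply/ffunP => -[x Ax]; rewrite !ffunE; apply/eqP/ab.
Qed.

Lemma prob_two_solutions a b :
  \sum_(f | solution f a && solution f b) system_prob f
    = \prod_i ((1 + [forall x in E i, a x == b x]%:R) / 4).
Proof.
under eq_bigr => i _ do rewrite -restrict_eq -prob_root2.
rewrite -system_prob_family; apply: eq_bigl => f.
apply/andP/forallP => [[/forallP fa /forallP fb] i|fab].
  by rewrite /= fa fb.
by split; apply/forallP => i; have /andP[] := fab i.
Qed.

Lemma first_moment :
  \sum_f system_prob f * (solution_number f)%:R = 2 ^+ #|X| / 2 ^+ m.
Proof.
under eq_bigr => f _ do
  rewrite /solution_number -sum1_card natr_sum mulr_sumr big_mkcond.
rewrite exchange_big /=.
transitivity (\sum_(a : {ffun X -> 'F_2}) (2 ^- m : rat)).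
  apply: eq_bigr => a _; rewrite -big_mkcond /=.
  under eq_bigr do rewrite mulr1.
  (* A single point is treated as the pair of equal points [a], [a], where each factor is (1 + 1) /
     4 = 1/2. *)
  under eq_bigl do rewrite inE -[solution _ _]andbb.
  rewrite prob_two_solutions (eq_bigr (fun=> 2^-1)) => [|i _].
    by rewrite prodr_const card_ord exprVn.
  have -> : [forall x in E i, a x == a x] by apply/forall_inP.
  by rewrite -[LHS]/((1 + 1) / 4); field.
by rewrite sumr_const card_ffun card_ord -[LHS]mulr_natl natrX.
Qed.

Lemma second_moment :
  \sum_f system_prob f * (solution_number f)%:R ^+ 2
    = 2 ^+ (2 * #|X|) / 2 ^+ (2 * m)
      * \sum_(I : {set 'I_m}) 2 ^- #|\bigcup_(i in I) E i|.
Proof.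
(* The square of the number of solutions counts ordered pairs of solutions. *)
transitivity (\sum_a \sum_b \sum_(f | solution f a && solution f b)
                system_prob f).
  under [RHS]eq_bigr => a _ do rewrite (exchange_big_dep xpredT) //=.
  rewrite exchange_big; apply: eq_bigr => f _ /=.
  transitivity (\sum_(a | solution f a) \sum_(b | solution f b) system_prob f).
    by rewrite !sumr_const -!mulrnA -[RHS]mulr_natr natrM expr2.
  rewrite [LHS]big_mkcond; apply: eq_bigr => a _.
  by case: ifP => fa; rewrite ?big_pred0_eq.
transitivity (\sum_(a : {ffun X -> 'F_2}) \sum_(b : {ffun X -> 'F_2})
  \sum_(I : {set 'I_m})
    (4 ^- m * [forall x in \bigcup_(i in I) E i, a x == b x]%:R : rat)).
  apply: eq_bigr => a _; apply: eq_bigr => b _.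
  rewrite prob_two_solutions big_split /= prodr_const card_ord exprVn mulrC.
  rewrite -mulr_sumr; congr (_ * _).
  (* With the indicator as first summand, [I] collects the factors in which the indicator is chosen.
     Their product is the indicator of agreement on the union of the edges in [I]. *)
  under eq_bigr do rewrite addrC.
  rewrite bigA_distr; apply: eq_bigr => I _.
  rewrite -big_mkcond -natr_prod /=.
  congr (_%:R); case: (boolP [forall x in \bigcup_(i in I) E i, _]) => [agree|].
    rewrite big1 // => i Ii; apply/eqP; rewrite eqb1.
    apply/forall_inP => x Ex; move/forall_inP: agree; apply.
    by apply/bigcupP; exists i.
  case/forall_inPn => x /bigcupP[i Ii Ex] abx.
  rewrite (bigD1 i) //=; suff -> : [forall x in E i, a x == b x] = false by [].
  by apply/negbTE/forall_inPn; exists x.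
under eq_bigr do rewrite exchange_big.
rewrite exchange_big /= mulr_sumr; apply: eq_bigr => I _.
(* For fixed [I], the number of [b] agreeing with [a] on the union does not depend on [a]. *)
transitivity (\sum_(a : {ffun X -> 'F_2})
    (4 ^- m * (2 ^+ #|X| / 2 ^+ #|\bigcup_(i in I) E i|) : rat)).
  apply: eq_bigr => a _; rewrite -mulr_sumr -(card_agree_on _ _ a).
  by rewrite -sum1_card natr_sum [in RHS]big_mkcond; congr (_ * _);
    apply: eq_bigr => b _; rewrite inE; case: ifP.
rewrite sumr_const card_ffun card_ord -[LHS]mulr_natl natrX.
rewrite mul2n -addnn exprD exprM (_ : 2 ^+ 2 = 4 :> rat) //.
(* The cardinal of ['F_2] appears in unfolded form and is convertible to 2. *)
rewrite -[(Zp_trunc _).+2]/2%N; ring.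
Qed.

Lemma consistent_solution_number f :
  consistent f = (0 < solution_number f)%N.
Proof. by apply/existsP/card_gt0P => -[a]; exists a. Qed.

Lemma consistency_prob_indicator :
  consistency_prob E = \sum_f system_prob f * (0 < solution_number f)%N%:R.
Proof.
rewrite /consistency_prob big_mkcond; apply: eq_bigr => f _.
by rewrite consistent_solution_number; case: ifP; rewrite ?mulr1 ?mulr0.
Qed.

End Moments.

Arguments solution_number {X m E} f.

(** The left side is N(3 - N)/2: it equals 0, 1, 1 at N = 0, 1, 2 and is at most 0 from 3 on. *)
Lemma indicator_ge_quadratic (N : nat) :
  3 / 2 * N%:R - 2^-1 * N%:R ^+ 2 <= (0 < N)%N%:R :> rat.
Proof.
case: N => [|[|[|N]]]; rewrite ?expr2 /=; [lra..|].
have : 3 <= N.+3%:R :> rat by rewrite ler_nat.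
nra.
Qed.

Theorem theorem6 (X : finType) (n m : nat) (hn : #|X| = n)
    (E : 'I_m -> {set X}) (hE : forall i : 'I_m, E i != set0) :
  3 * 2 ^+ n / 2 ^+ m.+1
    - 2 ^+ (2 * n) / 2 ^+ (2 * m).+1
      * (\sum_(I : {set 'I_m}) 2 ^- #|\bigcup_(i in I) E i|)
    <= consistency_prob E
  /\ consistency_prob E <= 2 ^+ n / 2 ^+ m.
Proof.
rewrite -{n hE}hn consistency_prob_indicator.
rewrite -(first_moment _ _ E); split; last first.
  apply: ler_sum => f _; apply: ler_wpM2l; first exact: system_prob_ge0.
  by rewrite ler_nat; case: solution_number.
have : \sum_(f : bsystem E) system_prob f *
    (3 / 2 * (solution_number f)%:R - 2^-1 * (solution_number f)%:R ^+ 2)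
    <= \sum_(f : bsystem E) system_prob f * (0 < solution_number f)%N%:R.
  apply: ler_sum => f _; apply: ler_wpM2l; first exact: system_prob_ge0.
  exact: indicator_ge_quadratic.
(* Only the left sides remain to be matched: by linearity the quadratic becomes a combination of the
   two moments, whose halves give the exponents [m.+1] and [(2 * m).+1]. *)
apply: etrans; congr (_ <= _); symmetry.
under eq_bigr do rewrite mulrBr (mulrCA _ (3 / 2)) (mulrCA _ 2^-1).
rewrite sumrB -(mulr_sumr _ _ _ (3 / 2)) -(mulr_sumr _ _ _ 2^-1).
rewrite first_moment second_moment !exprS !invfM; ring.
Qed.
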